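(* The maximal unbordered factor of a string of length $n$ over an alphabet $A$ of size $\sigma$ can be found in $\mathcal{O}\bigl(\frac{n^2}{\sigma^4}\bigr)$ expected time. That is, there are a deterministic algorithm which, given any string $S$ over $A$, correctly outputs a maximal unbordered factor of $S$, and an absolute constant $C$ such that for each $\sigma$ and all sufficiently large $n$ (depending on $\sigma$), the average of its running time over all $\sigma^n$ strings $S\in A^n$ is at most $C\,\frac{n^2}{\sigma^4}$.
   Context: $A^n$ is the set of all strings of length $n$ over the finite alphabet $A$; ''expected time'' means the running time averaged over the uniform distribution on input strings in $A^n$. Running time is the number of elementary operations (letter comparisons, arithmetic on and storage of integers of size at most $n$, array accesses) in the standard unit-cost RAM model. A factor of a string $S=S[1]\cdots S[n]$ is a contiguous substring $S[i..j]=S[i]\cdots S[j]$, $1\le i\le j\le n$. A prefix or suffix of $S$ is proper if it is non-empty and different from $S$. A border of a string is a proper prefix of it that is simultaneously a suffix of it. A string is unbordered if it has no border (in particular every string of length 1 is unbordered). The maximal unbordered factor of $S$ is a longest factor of $S$ that is unbordered. *)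

(* Defs.v *)
From mathcomp Require Import all_boot all_order all_algebra.
Set Implicit Arguments.
Unset Strict Implicit.
Unset Printing Implicit Defensive.
Import GRing.Theory Num.Theory.

Section Borders.
Variable A : eqType.
Implicit Types B S : seq A.

(* The factor S[i..j], with positions numbered from 1. *)
Definition factor S i j := drop i.-1 (take j S).

Definition factor_bounds S i j := 1 <= i <= j /\ j <= size S.

Definition border B S := [&& B != [::], B != S, prefix B S & suffix B S].

Definition unbordered S := forall B, ~~ border B S.

Definition maximal_unbordered_factor S i j :=
  [/\ factor_bounds S i j,
      unbordered (factor S i j) &
      forall i' j', factor_bounds S i' j' -> unbordered (factor S i' j') ->
        size (factor S i' j') <= size (factor S i j)].

End Borders.

(* Unit-cost RAM working on a read-only string S[1..n].
   The memory consists of integer registers and integer arrays, named by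
   natural numbers; a program, being a finite list of instructions, names only
   finitely many of them.  All stored integers lie in {0, ..., n}: an
   instruction producing a larger value faults.  Hence arrays are only ever
   accessed at indices 0, ..., n.
   The input is accessible only through equality tests between two of its
   letters, so that one program makes sense over every alphabet. *)

Inductive binop := OpAdd | OpSub | OpMul | OpDiv.

(* Subtraction is truncated at 0; the quotient by 0 is 0. *)
Definition eval_binop op : nat -> nat -> nat :=
  match op with
  | OpAdd => addn | OpSub => subn | OpMul => muln | OpDiv => divn
  end.

(* d, a, b name registers, t names an array, and l is a position in the
   program (numbered from 0). *)
Inductive instr :=
| Const (d k : nat)
| Move (d a : nat)
| Arith (op : binop) (d a b : nat)
| Get (d t a : nat)
| Put (t a b : nat)
| Jump (l : nat)
| JumpEq (a b l : nat)
| JumpLe (a b l : nat)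
| JumpLetterEq (a b l : nat)
| Halt.

Definition program := seq instr.

Record config := Config {
  pc : nat;
  reg : nat -> nat;
  arr : nat -> nat -> nat }.

Definition update T (f : nat -> T) k v : nat -> T :=
  fun x => if x == k then v else f x.

Section Semantics.
Variable A : eqType.
Implicit Types (P : program) (S : seq A) (c : config).

Definition letter S k : option A := if k is k'.+1 then onth S k' else None.

Definition set_reg S c d v : option config :=
  if v <= size S
  then Some (Config (pc c).+1 (update (reg c) d v) (arr c))
  else None.

Definition set_arr c t k v : config :=
  Config (pc c).+1 (reg c) (update (arr c) t (update (arr c t) k v)).

Definition branch c (b : bool) l : config :=
  Config (if b then l else (pc c).+1) (reg c) (arr c).

(* None: the machine has halted or faults. *)
Definition exec_instr S (ins : instr) c : option config :=
  let R := reg c in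
  match ins with
  | Const d k => set_reg S c d k
  | Move d a => set_reg S c d (R a)
  | Arith op d a b => set_reg S c d (eval_binop op (R a) (R b))
  | Get d t a => set_reg S c d (arr c t (R a))
  | Put t a b => Some (set_arr c t (R a) (R b))
  | Jump l => Some (branch c true l)
  | JumpEq a b l => Some (branch c (R a == R b) l)
  | JumpLe a b l => Some (branch c (R a <= R b) l)
  | JumpLetterEq a b l =>
      match letter S (R a), letter S (R b) with
      | Some x, Some y => Some (branch c (x == y) l)
      | _, _ => None
      end
  | Halt => None
  end.

Definition step P S c : option config :=
  if onth P (pc c) is Some ins then exec_instr S ins c else None.

(* Register 0 initially holds n, and the rest of the memory holds 0. *)
Definition init_config S : config :=
  Config 0 (update (fun _ => 0) 0 (size S)) (fun _ _ => 0).

Definition exec P S t : option config :=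
  iter t (obind (step P S)) (Some (init_config S)).

(* Every executed instruction costs one unit of time, the final Halt excepted.
   A fault is not a Halt, hence produces no output. *)
Definition outputs_in P S t i j : Prop :=
  exists c, [/\ exec P S t = Some c, onth P (pc c) = Some Halt,
                reg c 0 = i & reg c 1 = j].

Lemma outputs_in_unique P S t1 t2 i1 j1 i2 j2 :
  outputs_in P S t1 i1 j1 -> outputs_in P S t2 i2 j2 ->
  [/\ t1 = t2, i1 = i2 & j1 = j2].
Proof.
have stop t u c : exec P S t = Some c -> onth P (pc c) = Some Halt ->
    t < u -> exec P S u = None.
  move=> et hc; elim: u => // u IHu; rewrite ltnS leq_eqVlt.
  case/orP=> [/eqP <-|/IHu eu]; rewrite /exec /= -/(exec P S _).
    by rewrite et /= /step hc.
  by rewrite eu.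
move=> [c1 [e1 h1 <- <-]] [c2 [e2 h2 <- <-]].
case: (ltngtP t1 t2) => [lt|lt|eq_t].
- by rewrite (stop _ _ _ e1 h1 lt) in e2.
- by rewrite (stop _ _ _ e2 h2 lt) in e1.
- by move: e2; rewrite -eq_t e1 => -[->].
Qed.

End Semantics.

Definition average (A : finType) n (f : seq A -> nat) : rat :=
  ((\sum_(S : n.-tuple A) f S)%:R / (#|A| ^ n)%:R)%R.

(* Main.v *)
Require Import Defs.
From mathcomp Require Import all_boot all_order all_algebra.
From mathcomp Require Import zify.
Set Implicit Arguments.
Unset Strict Implicit.
Unset Printing Implicit Defensive.
Import GRing.Theory Num.Theory.
Local Open Scope ring_scope.

(* For each start i = 1, 2, ... the border table of S[i..n] (Knuth, Morris,
   Pratt) gives the longest unbordered prefix of S[i..n] in O(n) steps; the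
   search stops when the best length exceeds the number of remaining letters.
   If some unbordered factor has length l, this happens within n - l + 1 rounds,
   so the time is O(n (n - l + 1)).

   For sigma = 1 the worst case O(n^2) suffices.  For sigma > 1, as n is large
   compared with sigma, it is enough that, for some d depending
   only on sigma, all but a fraction O(1 / sigma^4) of the strings have an
   unbordered suffix of length at least n - d.  Let a be a letter different from
   the last one, and cut the beginning of S into T blocks of length m.  A suffix
   starting with a block a^m has no border of length at most m.  Each block is
   a^m with probability sigma^-m, so that some block is with probability at
   least 1 - sigma^m / T; and the suffix starting at a given block starts with
   a^m and has a border of length b > m with probability at most
   sigma^-(b + m), because a shortest border does not overlap itself.  Hence
   m = 8 and T = sigma^12 do. *)

(** * Borders of prefixes *)

Section Overlaps.
Local Open Scope nat_scope.
Variables (T : Type) (w : nat -> T).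

(** The lengths [b = 0] and [b = q] always satisfy this, hence the bounds on [b] where proper
    borders are meant. *)
Definition overlap q b := forall x, x < b -> w x = w (q - b + x).

Definition borderless q := forall b, 0 < b < q -> ~ overlap q b.

Definition longest_overlap q k :=
  [/\ k < q, overlap q k & forall b, b < q -> overlap q b -> b <= k].

Lemma overlapS q b :
  b < q -> overlap q.+1 b.+1 <-> overlap q b /\ w b = w q.
Proof.
move=> lt_bq; split=> [ov | [ov eq_bq] x].
  split=> [x lt_xb|]; first by rewrite ov ?subSS // ltnW.
  by rewrite ov // subSS subnK // ltnW.
rewrite ltnS leq_eqVlt subSS => /orP[/eqP->|]; last exact: ov.
by rewrite eq_bq subnK // ltnW.
Qed.

Lemma overlap_nested q k b :
  k <= q -> b <= k -> overlap q k -> overlap q b -> overlap k b.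
Proof.
move=> le_kq le_bk ov_k ov_b x lt_xb.
rewrite ov_b // [RHS]ov_k; last by lia.
by congr w; lia.
Qed.

Lemma overlap_trans q k b :
  k <= q -> b <= k -> overlap q k -> overlap k b -> overlap q b.
Proof.
move=> le_kq le_bk ov_k ov_b x lt_xb.
rewrite ov_b // ov_k; last by lia.
by congr w; lia.
Qed.

Lemma longest_overlap0 q : longest_overlap q 0 -> borderless q.
Proof. by case=> _ _ max0 b /andP[b0 bq] /(max0 b bq); case: b b0 {bq}. Qed.

Lemma borderless_longest_overlap q k :
  longest_overlap q k -> borderless q -> k = 0.
Proof. by case=> kq ov _ noov; case: k kq ov => // k kq /noov []. Qed.

(* A border longer than half of the word overlaps itself in a shorter one. *)
Lemma borderless_short q :
  (forall b, 0 < b -> b.*2 <= q -> ~ overlap q b) -> borderless q.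
Proof.
move=> short b; elim/ltn_ind: b => b IHb /andP[b0 bq] ov.
have [le_bq | lt_qb] := leqP b.*2 q; first exact: short ov.
apply: (IHb (b.*2 - q)) => [||x lt_x]; try lia.
rewrite ov; last by lia.
rewrite ov; last by lia.
by congr w; lia.
Qed.

Lemma longest_overlap_extend q k :
  k < q -> overlap q k -> w k = w q ->
  (forall b, b < q -> overlap q b -> w b = w q -> b <= k) ->
  longest_overlap q.+1 k.+1.
Proof.
move=> kq ov eqk max; split=> //; first by apply/overlapS.
by case=> // b; rewrite ltnS => bq /(overlapS bq) [ovb eqb]; apply: max.
Qed.

Lemma longest_overlap_reset q :
  w 0 <> w q ->
  (forall b, b < q -> overlap q b -> w b = w q -> b <= 0) ->
  longest_overlap q.+1 0.
Proof.
move=> ne max; split=> //; case=> // b; rewrite ltnS => bq /(overlapS bq) [ovb eqb].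
by have:= max b bq ovb eqb; rewrite leqn0 => /eqP b0; rewrite b0 in eqb.
Qed.

End Overlaps.

(** * Unbordered factors in terms of overlaps *)

Section Factors.
Local Open Scope nat_scope.
Variable A : eqType.
Implicit Types S U : seq A.

Lemma unborderedP U :
  unbordered U <-> forall b, 0 < b < size U -> take b U <> drop (size U - b) U.
Proof.
split=> [unb b /andP[b0 bU] eq_td | H B].
  have := unb (take b U); case/negP; apply/and4P; split.
  - by rewrite -size_eq0 size_take bU -lt0n.
  - by apply/eqP=> /(congr1 size); rewrite size_take bU; lia.
  - exact: prefix_take.
  - by rewrite eq_td; apply: suffix_drop.
apply/and4P=> -[B0 BU pre suf].
have leBU := size_prefix pre.
have szB : size B < size U.
  rewrite ltn_neqAle leBU andbT; apply/eqP=> eq_sz.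
  by move: pre BU; rewrite prefixE eq_sz take_size eq_sym => ->.
apply: (H (size B)); first by rewrite szB lt0n size_eq0 B0.
by move: pre suf; rewrite prefixE suffixE => /eqP-> /eqP->.
Qed.

Lemma onth_take S k x : x < k -> onth (take k S) x = onth S x.
Proof. by move=> xk; rewrite !onthE map_take nth_take. Qed.

Lemma onth_drop S k x : onth (drop k S) x = onth S (k + x).
Proof. by rewrite !onthE map_drop nth_drop. Qed.

Lemma size_factor S i j :
  factor_bounds S i j -> size (factor S i j) = (j - i).+1.
Proof.
by case=> /andP[i0 ij] jS; rewrite size_drop size_takel //; lia.
Qed.

Lemma onth_factor S i j x : factor_bounds S i j ->
  x < (j - i).+1 -> onth (factor S i j) x = letter S (i + x).
Proof.
case: i => [|i] [/andP[i0 ij] jS] //= ltx.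
by rewrite /factor onth_drop onth_take; last by lia.
Qed.

Lemma unbordered_factorP S i j : factor_bounds S i j ->
  unbordered (factor S i j) <->
  borderless (fun x => letter S (i + x)) (j - i).+1.
Proof.
move=> bnd; have sz := size_factor bnd.
rewrite unborderedP sz; split=> H b /[dup] hb /andP[b0 bj].
  move=> ov; apply: (H b hb); apply/eq_from_onth => x.
  rewrite onth_drop; have [xb|bx] := ltnP x b.
    rewrite onth_take // !onth_factor //; [exact: ov | lia | lia].
  by rewrite !onth_default ?size_takel ?sz //; lia.
move=> eq_td; apply: (H b hb) => x xb.
rewrite -(onth_factor bnd) -?(onth_factor bnd); try lia.
by rewrite -onth_drop -eq_td onth_take.
Qed.

End Factors.

(** * The program and its running time *)

(* Jump targets are positions in the list.  Registers: r4 is the start i of the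
   suffix, r7 an offset in it, r6 a border length, r8 = n - i, r5 = 1, r9 = 0;
   r3, r2 and r1 are the length, start and end of the best factor so far.
   Array 0 is the border table.  Sums are ordered so that none exceeds n. *)
Definition scan_program : program :=
  [:: Const 5 1; Const 4 1;
      (* 2: scan the suffix starting at r4 *)
      Arith OpSub 8 0 4; Const 6 0; Const 7 0;
      (* 5: r6 is the longest border length of the prefix of length r7 + 1 *)
      Arith OpAdd 10 7 5; Put 0 10 6; JumpEq 6 9 9; Jump 13;
      JumpLe 10 3 13; Move 3 10; Move 2 4; Arith OpAdd 1 4 7;
      (* 13: next letter *)
      JumpEq 7 8 23; Arith OpAdd 7 7 5; Arith OpAdd 12 4 7;
      (* 16: try to extend the border of length r6 *)
      Arith OpAdd 11 4 6; JumpLetterEq 11 12 21; JumpEq 6 9 5; Get 6 0 6;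
      Jump 16;
      Arith OpAdd 6 6 5; Jump 5;
      (* 23: the suffix is exhausted *)
      JumpLe 8 3 26; Arith OpAdd 4 4 5; Jump 2;
      Move 0 2; Halt].

(** * Reachability within a step budget *)

Section Reaching.
Local Open Scope nat_scope.
Variables (A : eqType) (P : program) (S : seq A).
Implicit Types (c : config) (Q : config -> Prop).

Definition reaches Q t c := exists u c',
  [/\ u <= t, iter u (obind (step P S)) (Some c) = Some c' & Q c'].

Lemma reaches_here Q t c : Q c -> reaches Q t c.
Proof. by move=> Qc; exists 0, c. Qed.

Lemma reaches_step Q t c c' :
  step P S c = Some c' -> reaches Q t c' -> reaches Q t.+1 c.
Proof.
move=> st [u [d [ut it Qd]]]; exists u.+1, d; split=> //.
by rewrite iterSr /= st.
Qed.

Lemma reaches_le Q t t' c : t <= t' -> reaches Q t c -> reaches Q t' c.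
Proof.
by move=> le [u [d [ut it Qd]]]; exists u, d; split=> //; apply: leq_trans le.
Qed.

Lemma set_regE c d v : v <= size S ->
  set_reg S c d v = Some (Config (pc c).+1 (update (reg c) d v) (arr c)).
Proof. by rewrite /set_reg => ->. Qed.

Lemma exec_JumpLetterEq c a b l :
  0 < reg c a <= size S -> 0 < reg c b <= size S ->
  exec_instr S (JumpLetterEq a b l) c =
  Some (branch c (letter S (reg c a) == letter S (reg c b)) l).
Proof.
have someP k : 0 < k <= size S -> exists x, letter S k = Some x.
  case: k => //= k lt_kS; have: onth S k by rewrite onthTE.
  by case: (onth S k) => // x _; exists x.
by move=> /someP[x /= ->] /someP[y ->]; rewrite (inj_eq Some_inj).
Qed.

End Reaching.

(** * Loop invariants and step counts of the scan *)

Section Scan.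
Local Open Scope nat_scope.
Variables (A : eqType) (S : seq A).
Let n := size S.
Let w i x := letter S (i + x).
Implicit Types (R : nat -> nat) (F : nat -> nat -> nat).

Notation reaches := (reaches scan_program S).

Definition constants i R :=
  [/\ R 0 = n, R 5 = 1, R 9 = 0, R 4 = i & R 8 = n - i].

Definition best (seen : nat -> nat -> bool) R :=
  (forall i q, 0 < i -> i + q <= n.+1 -> 0 < q -> seen i q ->
     borderless (w i) q -> q <= R 3) /\
  (0 < R 3 -> [/\ 0 < R 2, (R 1).+1 = R 2 + R 3, R 1 <= n &
     borderless (w (R 2)) (R 3)]).

Definition seen_upto i d i' q := (i' < i) || ((i' == i) && (q <= d)).

(** Entries beyond [d] are left free: they may be stale values from earlier starts. *)
Definition table i d F :=
  forall x, 0 < x <= d -> longest_overlap (w i) x (F 0 x).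

Definition at_record i d k c :=
  exists R F, [/\ c = Config 5 R F, constants i R, R 7 = d, R 6 = k &
  [/\ 0 < i, i + d <= n, longest_overlap (w i) d.+1 k, table i d F &
    best (seen_upto i d) R]].

Definition at_next i d k c :=
  exists R F, [/\ c = Config 13 R F, constants i R, R 7 = d, R 6 = k &
  [/\ 0 < i, i + d <= n, longest_overlap (w i) d.+1 k, table i d.+1 F &
    best (seen_upto i d.+1) R]].

(** Here [k] bounds only the borders that the letter [w i d] extends; longer ones may have been
    rejected. *)
Definition at_extend i d k c :=
  exists R F, [/\ c = Config 16 R F, constants i R, R 7 = d, R 6 = k &
  [/\ R 12 = i + d, 0 < i & i + d <= n] /\
  [/\ k < d, overlap (w i) d k &
    forall b, b < d -> overlap (w i) d b -> w i b = w i d -> b <= k] /\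
  table i d F /\ best (seen_upto i d) R].

Definition at_suffix i c :=
  exists R F, [/\ c = Config 2 R F, [/\ R 0 = n, R 5 = 1, R 9 = 0 & R 4 = i],
    0 < i <= n & best (seen_upto i 0) R].

Definition at_suffix_end i c :=
  exists R F, [/\ c = Config 23 R F, constants i R,
    0 < i <= n & best (seen_upto i (n - i).+1) R].

Ltac exec_set := eapply reaches_step;
  [rewrite /step /= set_regE; [reflexivity | rewrite /update /=]
  | cbn [pc reg arr]].
Ltac exec_jump := eapply reaches_step;
  [reflexivity | rewrite /branch /set_arr; cbn [pc reg arr]].

(** Amortization with potential [5 * k]: a fallback takes 5 steps and lowers [k]; a success takes 4
    steps and raises [k] by 1, which gives the 9. *)
Lemma extend_reaches Q B i d :
  (forall k c, at_record i d k c -> reaches Q (B + 5 * k) c) ->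
  forall k c, at_extend i d k c -> reaches Q (B + 5 * k + 9) c.
Proof.
move=> HQ; elim/ltn_ind => k IHk c [R [F [-> [R0 R5 R9 R4 R8] R7 R6]]].
case=> [[R12 i0 idn]] [[kd ov max] [tab bst]].
have test t : reaches Q t (Config (if w i k == w i d then 21 else 18)
    (update R 11 (R 4 + R 6)) F) -> reaches Q t.+2 (Config 16 R F).
  move=> rt; exec_set; first by rewrite R4 R6 -/n; lia.
  eapply reaches_step; last exact: rt.
  set c17 := (X in step _ _ X).
  transitivity (exec_instr S (JumpLetterEq 11 12 21) c17) => //.
  rewrite exec_JumpLetterEq /c17 /update /= ?R4 ?R6 ?R12 //.
    by rewrite -/n; lia.
  by rewrite -/n; lia.
have [eqk|nek] := eqVneq (w i k) (w i d).
  apply: (@reaches_le _ _ _ _ (B + 5 * k.+1).+4); first by lia.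
  apply: test; rewrite eqk eqxx.
  exec_set; first by rewrite R5 R6 -/n; lia.
  exec_jump.
  apply: HQ; eexists _, _; split; first by reflexivity.
  - by [].
  - by [].
  - by rewrite /update /= R5 R6 addn1.
  split=> //; exact: longest_overlap_extend.
have [k0|k_gt0] := posnP k.
  rewrite k0 in R6 kd ov max nek test *.
  apply: (@reaches_le _ _ _ _ (B + 5 * 0).+3); first by lia.
  apply: test; rewrite (negPf nek).
  exec_jump; rewrite /update /= R6 R9 /=.
  apply: HQ; eexists _, _; split; first by reflexivity.
  - by [].
  - by [].
  - by [].
  by split=> //; apply: longest_overlap_reset max; apply/eqP.
have [lt_k' ov' max'] : longest_overlap (w i) k (F 0 k) by apply: tab; lia.
apply: (@reaches_le _ _ _ _ (B + 5 * F 0 k + 9).+1.+4); first by lia.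
apply: test; rewrite (negPf nek).
exec_jump; rewrite {1 2}/update /= R6 R9 eqn0Ngt k_gt0 /=.
exec_set; first by rewrite R6 -/n; lia.
exec_jump.
apply: (IHk _ lt_k'); eexists _, _; split; first by reflexivity.
- by [].
- by [].
- by rewrite /update /= R6.
split; first by [].
split; last by [].
split; first by lia.
  exact: (overlap_trans (ltnW kd) (ltnW lt_k') ov ov').
(* The letter after the border of length [k] mismatches, so an extendable border is strictly
   shorter. *)
move=> b bd ovb eqb; apply: max'.
  rewrite ltn_neqAle max // andbT; apply: contraNneq nek => <-.
  by rewrite eqb.
exact: (overlap_nested (ltnW kd) (max b bd ovb eqb) ov ovb).
Qed.

Lemma best_skip (seen seen' : nat -> nat -> bool) R R' :
  R' 1 = R 1 -> R' 2 = R 2 -> R' 3 = R 3 ->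
  (forall i q, 0 < i -> i + q <= n.+1 -> 0 < q -> seen' i q ->
     borderless (w i) q -> seen i q \/ q <= R 3) ->
  best seen R -> best seen' R'.
Proof.
move=> e1 e2 e3 sub [max unb]; split=> [i q i0 iq q0 siq biq|].
  by rewrite e3; have [|//] := sub _ _ i0 iq q0 siq biq; move/max; apply.
by rewrite e1 e2 e3.
Qed.

Lemma seen_uptoS i d i' q :
  seen_upto i d.+1 i' q -> seen_upto i d i' q \/ i' = i /\ q = d.+1.
Proof.
rewrite /seen_upto [q <= d.+1]leq_eqVlt ltnS.
by case: (i' < i) => //=; [left | case: eqP => //= ->; case/orP=> [/eqP|]; auto].
Qed.

Lemma record_reaches_next Q t i d k c :
  at_record i d k c -> (forall c, at_next i d k c -> reaches Q t c) ->
  reaches Q (t + 7) c.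
Proof.
move=> [R [F [-> [R0 R5 R9 R4 R8] R7 R6 [i0 idn lo tab bst]]]] HQ.
set F' := update F 0 (update (F 0) d.+1 k).
have tab' : table i d.+1 F'.
  move=> x xd; rewrite /F' /update /=; case: eqP => [->|/eqP nx] //.
  by apply: tab; lia.
have finish R' : constants i R' -> R' 7 = d -> R' 6 = k ->
    best (seen_upto i d.+1) R' -> reaches Q t (Config 13 R' F').
  by move=> *; apply: HQ; exists R', F'.
have start t' : reaches Q t' (Config (if k == 0 then 9 else 8)
      (update R 10 d.+1) F') -> reaches Q t'.+3 (Config 5 R F).
  move=> rt; exec_set; first by rewrite R7 R5 -/n; lia.
  rewrite R7 R5 addn1.
  exec_jump; exec_jump.
  have -> : update R 10 d.+1 10 = d.+1 by [].
  have -> : update R 10 d.+1 6 = k by [].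
  by have -> : update R 10 d.+1 9 = 0 by [].
have [k0|k_gt0] := posnP k; last first.
  apply: (@reaches_le _ _ _ _ t.+4); first by lia.
  apply: start; rewrite eqn0Ngt k_gt0 /=.
  exec_jump; apply: finish => //.
  apply: best_skip bst => // i' q _ _ _ /seen_uptoS[|[-> ->] bl]; first by left.
  by rewrite (borderless_longest_overlap lo bl) in k_gt0.
have bl : borderless (w i) d.+1 by apply: longest_overlap0; rewrite -k0.
have [le_q3 | gt_q3] := leqP d.+1 (R 3).
  apply: (@reaches_le _ _ _ _ t.+4); first by lia.
  apply: start; rewrite k0 /=.
  exec_jump; have -> : update R 10 d.+1 10 = d.+1 by [].
  have -> : update R 10 d.+1 3 = R 3 by [].
  rewrite le_q3.
  apply: finish => //.
  by apply: best_skip bst => // i' q _ _ _ /seen_uptoS[|[-> ->]]; [left | right].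
apply: (@reaches_le _ _ _ _ t.+4.+3); first by lia.
apply: start; rewrite k0 /=.
exec_jump; have -> : update R 10 d.+1 10 = d.+1 by [].
have -> : update R 10 d.+1 3 = R 3 by [].
rewrite leqNgt gt_q3 /=.
exec_set; first by rewrite -/n; lia.
exec_set; first by rewrite R4 -/n; lia.
exec_set; first by rewrite R4 R7 -/n; lia.
apply: finish => //.
case: bst => max unb; split=> [i' q i'0 iq q0|_].
  case/seen_uptoS=> [sn|[-> ->]] // bl'.
  by apply: (leq_trans (max _ _ i'0 iq q0 sn bl')); apply: ltnW.
by rewrite /update /= R4 R7; split=> //; lia.
Qed.

(** Each further letter costs at most 7 steps to record, 3 to advance and 9 amortized to extend,
    within 20. *)
Lemma record_reaches_end Q B i :
  (forall c, at_suffix_end i c -> reaches Q B c) ->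
  forall d k c, at_record i d k c ->
  reaches Q (B + 20 * (n - i - d) + 5 * k + 12) c.
Proof.
move=> HQ d; move e: (n - i - d) => r.
elim: r d e => [|r IHr] d e k c rec.
  apply: (@reaches_le _ _ _ _ (B.+1 + 7)); first by lia.
  apply: record_reaches_next rec _ => {}c.
  move=> [R [F [-> [R0 R5 R9 R4 R8] R7 R6 [i0 idn lo tab bst]]]].
  have d_eq : d = n - i by lia.
  exec_jump; rewrite R7 R8 -d_eq eqxx; apply: HQ.
  by exists R, F; split=> //; [lia | rewrite -d_eq].
apply: (@reaches_le _ _ _ _ ((B + 20 * r + 12 + 5 * k + 9).+3 + 7)); first by lia.
apply: record_reaches_next rec _ => {}c.
move=> [R [F [-> [R0 R5 R9 R4 R8] R7 R6 [i0 idn lo tab bst]]]].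
have d_eq : (d == n - i) = false by lia.
exec_jump; rewrite R7 R8 d_eq.
exec_set; first by rewrite R7 R5 -/n; lia.
exec_set; first by rewrite R4 R7 R5 -/n; lia.
apply: (extend_reaches (i := i) (d := d.+1)) => [k' c' rec'|].
  apply: reaches_le (IHr d.+1 _ k' c' rec'); lia.
have [kd ov max] := lo.
eexists _, _; split; first by reflexivity.
- by [].
- by rewrite /update /= R7 R5 addn1.
- by [].
split; first by split; [rewrite /update /= R4 R7 R5 addn1 | |lia].
by split; first by split=> // b bd ovb _; apply: max.
Qed.

Lemma suffix_reaches_end Q B i :
  (forall c, at_suffix_end i c -> reaches Q B c) ->
  forall c, at_suffix i c -> reaches Q (B + 20 * (n - i) + 15) c.
Proof.
move=> HQ c [R [F [-> [R0 R5 R9 R4] /andP[i0 le_in] bst]]].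
apply: (@reaches_le _ _ _ _ (B + 20 * (n - i - 0) + 5 * 0 + 12).+3); first by lia.
exec_set; first by rewrite R0 R4 -/n; lia.
do 2!exec_set => //.
apply: record_reaches_end HQ _ _ _ _.
eexists _, _; split; first by reflexivity.
- by split; rewrite /update //= R0 R4.
- by [].
- by [].
split=> //; first by lia.
by case=> [|x] /andP[].
Qed.

Definition finished c :=
  [/\ onth scan_program (pc c) = Some Halt, 0 < reg c 0 <= reg c 1, reg c 1 <= n,
    borderless (w (reg c 0)) (reg c 1 - reg c 0).+1 &
    forall i q, 0 < i -> i + q <= n.+1 -> 0 < q -> borderless (w i) q ->
      q <= (reg c 1 - reg c 0).+1].

Lemma borderless1 i : borderless (w i) 1.
Proof. by case=> // b /andP[]. Qed.

(* Once the start of a factor of length [l] has been passed, the best length is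
   at least [l], so the scan stops as soon as at most [l] letters remain. *)
Lemma suffix_finishes i0 l : 0 < i0 -> i0 + l <= n.+1 -> 0 < l ->
  borderless (w i0) l ->
  forall i c, i + l <= n.+1 -> at_suffix i c ->
  reaches finished (20 * n * (n.+2 - l - i)) c.
Proof.
move=> i0_gt0 i0l l_gt0 bl i; move e: (n.+1 - l - i) => r.
elim/ltn_ind: r i e => r IHr i e c il at_i.
have /andP[i_gt0 _] : 0 < i <= n by case: at_i => R [F [_ _ ? _]].
(* A round costs at most [20 * (n - i) + 18], below [20 * n] because [i] is positive. *)
apply: (@reaches_le _ _ _ _ (20 * n * (n.+2 - l - i.+1) + 3 + 20 * (n - i) + 15)).
  have -> : n.+2 - l - i = (n.+2 - l - i.+1).+1 by lia.
  by nia.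
apply: suffix_reaches_end at_i => {}c.
move=> [R [F [-> [R0 R5 R9 R4 R8] /andP[_ le_in] [max unb]]]].
have seen_le i' q : 0 < i' -> i' + q <= n.+1 -> 0 < q -> i' <= i ->
    borderless (w i') q -> q <= R 3.
  move=> i'0 iq q0 le_i'; apply: max => //.
  rewrite /seen_upto; move: le_i'; rewrite leq_eqVlt => /orP[/eqP E|->] //.
  by rewrite E eqxx /=; lia.
have [stop | continue] := leqP (n - i) (R 3); last first.
  (* Otherwise [i0] has been passed, so that [R 3] is at least [l], which exceeds [n - i]. *)
  have lt_i : i.+1 + l <= n.+1.
    rewrite leqNgt; apply/negP=> gt_i.
    have le_i0i : i0 <= i by lia.
    by have := seen_le _ _ i0_gt0 i0l l_gt0 le_i0i bl; lia.
  rewrite addnS addn2.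
  exec_jump; rewrite R8 leqNgt continue /=.
  exec_set; first by rewrite R4 R5 -/n; lia.
  exec_jump; apply: IHr; [|reflexivity| |]; try lia.
  eexists _, _; split; first by reflexivity.
  - by split; rewrite /update //= R4 R5 addn1.
  - by lia.
  split=> // i' q i'0 iq q0.
  rewrite /seen_upto ltnS (_ : q <= 0 = false) ?andbF ?orbF; last by lia.
  exact: seen_le.
apply: (@reaches_le _ _ _ _ 2); first by rewrite addn3.
exec_jump; rewrite R8 stop.
have R3_gt0 : 0 < R 3 by apply: (seen_le i 1) => //; [lia | exact: borderless1].
have [R2 R1 R1n bR] := unb R3_gt0.
exec_set; first by rewrite -/n; lia.
apply: reaches_here.
have e3 : (R 1 - R 2).+1 = R 3 by lia.
split; rewrite /update //= ?e3 //; first by lia.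
move=> i' q i'0 iq q0 bq; have [le_i' | lt_i'] := leqP i' i.
  exact: seen_le bq.
by lia.
Qed.

Lemma scan_finishes i0 l : 0 < i0 -> i0 + l <= n.+1 -> 0 < l ->
  borderless (w i0) l ->
  reaches finished (22 * n * (n.+1 - l)) (init_config S).
Proof.
move=> i0_gt0 i0l l_gt0 bl.
apply: (@reaches_le _ _ _ _ (20 * n * (n.+2 - l - 1)).+2).
  have -> : n.+2 - l - 1 = n.+1 - l by lia.
  have : 0 < n * (n.+1 - l) by rewrite muln_gt0; lia.
  by rewrite -!mulnA; lia.
exec_set; first by rewrite -/n; lia.
exec_set; first by rewrite -/n; lia.
apply: (suffix_finishes i0_gt0 i0l l_gt0 bl (i := 1)); first by lia.
eexists _, _; split; first by reflexivity.
- by [].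
- by lia.
split=> // i q i0' iq q0; rewrite /seen_upto; lia.
Qed.

End Scan.

(** * Correctness and worst-case time *)

Section ScanProgram.
Local Open Scope nat_scope.
Variable A : eqType.
Implicit Type S : seq A.

Lemma scan_outputs S i0 j0 :
  factor_bounds S i0 j0 -> unbordered (factor S i0 j0) ->
  exists t i j,
    [/\ t <= 22 * size S * ((size S).+1 - size (factor S i0 j0)),
        outputs_in scan_program S t i j & maximal_unbordered_factor S i j].
Proof.
move=> bnd unb; have := size_factor bnd; move: (size _) => l l_eq.
have [/andP[i0_gt0 le_ij] le_jn] := bnd.
move/(unbordered_factorP bnd): unb; rewrite -l_eq => bl.
have l_gt0 : 0 < l by lia.
have i0l : i0 + l <= (size S).+1 by lia.
have [t [c [le_t it [halt]]]] := scan_finishes i0_gt0 i0l l_gt0 bl.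
move=> /andP[r0 r01] r1n br maxr.
have bndr : factor_bounds S (reg c 0) (reg c 1) by split=> //; apply/andP.
exists t, (reg c 0), (reg c 1); split=> //; first by exists c.
split=> //; first exact/(unbordered_factorP bndr).
move=> i j bndij unbij; have [/andP[i_gt0 leij] lejn] := bndij.
rewrite !size_factor //; apply: (maxr i) => //; first by lia.
exact/(unbordered_factorP bndij).
Qed.

Definition halts P S t :=
  if exec P S t is Some c
  then if onth P (pc c) is Some Halt then true else false else false.

Lemma haltsP P S t : reflect (exists i j, outputs_in P S t i j) (halts P S t).
Proof.
rewrite /halts; apply: (iffP idP) => [|[i [j [c [-> -> _ _]]]]] //.
case e: exec => [c|//] //; case h: onth => [[]|] // _.
by exists (reg c 0), (reg c 1), c.
Qed.

(** The time is made a function of [S] by a search up to the quadratic worst case. *)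
Definition scan_time S :=
  find (halts scan_program S) (iota 0 (22 * size S * size S).+1).

Lemma scan_time_eq S t i j : t <= 22 * size S * size S ->
  outputs_in scan_program S t i j -> scan_time S = t.
Proof.
move=> le_t out_t; set s := iota 0 (22 * size S * size S).+1.
have has_s : has (halts scan_program S) s.
  apply/hasP; exists t; first by rewrite mem_iota.
  by apply/haltsP; exists i, j.
have := has_s; rewrite has_find size_iota => lt_f.
have /haltsP[i' [j' out]] := nth_find 0 has_s.
rewrite nth_iota // add0n in out.
by have [] := outputs_in_unique out out_t.
Qed.

Lemma scan_correct S : S <> [::] -> exists i j,
  outputs_in scan_program S (scan_time S) i j /\ maximal_unbordered_factor S i j.
Proof.
move=> S0; have S_gt0 : 0 < size S by case: S S0.
have bnd : factor_bounds S 1 1 by split.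
have unb1 : unbordered (factor S 1 1).
  exact/(unbordered_factorP bnd)/borderless1.
have [t [i [j [le_t out max]]]] := scan_outputs bnd unb1.
rewrite (size_factor bnd) !subSS !subn0 in le_t.
by exists i, j; split=> //; rewrite (scan_time_eq le_t out).
Qed.

Lemma scan_time_le S i j : factor_bounds S i j -> unbordered (factor S i j) ->
  scan_time S <= 22 * size S * ((size S).+1 - size (factor S i j)).
Proof.
move=> bnd unb; have [t [i' [j' [le_t out _]]]] := scan_outputs bnd unb.
rewrite (scan_time_eq _ out) //; apply: leq_trans le_t _.
by rewrite leq_mul2l size_factor // !subSS leq_subr orbT.
Qed.

Lemma scan_time_le_sqr S : S <> [::] -> scan_time S <= 22 * size S * size S.
Proof.
move=> S0; have bnd : factor_bounds S 1 1 by split; case: S S0.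
have:= @scan_time_le S 1 1 bnd; rewrite (size_factor bnd) !subSS !subn0; apply.
exact/(unbordered_factorP bnd)/borderless1.
Qed.

End ScanProgram.

(** * Counting strings without long unbordered suffixes *)

Section Counting.
Local Open Scope nat_scope.
Variable A : finType.

Lemma leq_card_bigcup (T : finType) (I : Type) (r : seq I) (p : pred I)
    (F : I -> {set T}) :
  #|\bigcup_(i <- r | p i) F i| <= \sum_(i <- r | p i) #|F i|.
Proof.
elim/big_ind2: _ => [|U a V b Ua Vb|//]; first by rewrite cards0.
by rewrite cardsU (leq_trans (leq_subr _ _)) ?leq_add.
Qed.

(* Overwriting the determined letters by an arbitrary tuple is injective. *)
Lemma card_determined n d (e : 'I_d -> 'I_n) (E : {set n.-tuple A}) :
  injective e ->
  {in E &, forall S S', (forall x, x \notin codom e -> tnth S x = tnth S' x) ->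
     S = S'} ->
  #|E| * #|A| ^ d <= #|A| ^ n.
Proof.
move=> inj_e detE; rewrite -!card_tuple -cardsT -cardsX.
pose phi (p : n.-tuple A * d.-tuple A) : n.-tuple A :=
  [tuple if [pick j | e j == x] is Some j then tnth p.2 j else tnth p.1 x
    | x < n].
have phi_e p j : tnth (phi p) (e j) = tnth p.2 j.
  rewrite tnth_mktuple; case: pickP => [j' /eqP/inj_e-> //|/(_ j)].
  by rewrite eqxx.
have phi_ne p x : x \notin codom e -> tnth (phi p) x = tnth p.1 x.
  move=> xe; rewrite tnth_mktuple; case: pickP => // j /eqP xj.
  by rewrite -xj codom_f in xe.
rewrite -(card_in_imset (f := phi)) ?max_card // => -[S c] [S' c'].
rewrite !inE !andbT /= => SE S'E eq_phi; congr (_, _).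
  by apply: detE => // x xe; rewrite -(phi_ne (S, c)) // eq_phi phi_ne.
by apply: eq_from_tnth => j; rewrite -(phi_e (S, c)) eq_phi phi_e.
Qed.

Definition hits n d (e : 'I_d -> 'I_n) a (S : n.-tuple A) :=
  [forall j, tnth S (e j) == a].

(* Force a string without hits to hit exactly one block: that block can be read
   off the result, so only its old contents are lost. *)
Lemma card_no_hit n d k (e : 'I_k -> 'I_d -> 'I_n) (g : n.-tuple A -> A) :
  (forall t j t' j', e t j = e t' j' -> t = t' /\ j = j') ->
  (forall S S' : n.-tuple A,
     (forall x, (forall t j, x != e t j) -> tnth S x = tnth S' x) ->
     g S = g S') ->
  #|[set S | [forall t, ~~ hits (e t) (g S) S]]| * k <= #|A| ^ (n + d).
Proof.
move=> inj_e inv_g; set Z := [set S | _].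
rewrite expnD -!card_tuple -{1}(card_ord k) -cardsT -cardsX -card_prod.
pose over (S : n.-tuple A) t : n.-tuple A :=
  [tuple if x \in codom (e t) then g S else tnth S x | x < n].
pose phi (p : n.-tuple A * 'I_k) : n.-tuple A * d.-tuple A :=
  (over p.1 p.2, [tuple tnth p.1 (e p.2 j) | j < d]).
have over_e S t j : tnth (over S t) (e t j) = g S.
  by rewrite tnth_mktuple codom_f.
have over_ne S t x : x \notin codom (e t) -> tnth (over S t) x = tnth S x.
  by rewrite tnth_mktuple => /negPf->.
have g_over S t : g (over S t) = g S.
  apply: inv_g => x ne_x; apply/over_ne/codomP=> -[j /eqP].
  by rewrite (negPf (ne_x t j)).
(* If [t] differed from [t'], block [t] of [S'] would be intact in the result and thus already a
   hit. *)
have over_inj S t S' t' : S' \in Z -> over S t = over S' t' -> t = t'.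
  rewrite inE => /forallP/(_ t) nohit eq_over.
  have [//|ne_t] := eqVneq t t'; case/forallP: nohit => j.
  rewrite -(over_ne S' t'); last first.
    by apply/codomP=> -[j' /inj_e[/eqP]]; rewrite (negPf ne_t).
  by rewrite -eq_over over_e -(g_over S t) eq_over g_over.
rewrite -(card_in_imset (f := phi)) ?max_card // => -[S t] [S' t'].
rewrite !inE /= !andbT => SZ S'Z eq_phi.
have eq_over : over S t = over S' t' := congr1 fst eq_phi.
have eq_c := congr1 snd eq_phi; rewrite /= in eq_c.
have et : t = t' by apply: over_inj eq_over; rewrite inE.
rewrite -et in eq_over eq_c *.
congr (_, _); apply: eq_from_tnth => x.
have [/codomP[j ->]|xe] := boolP (x \in codom (e t)).
  by have := congr1 (fun c => tnth c j) eq_c; rewrite !tnth_mktuple.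
by rewrite -(over_ne S t) // eq_over over_ne.
Qed.

(** A geometric series of ratio at least 2 stays below the power following its largest term. *)
Lemma sum_expn_lt s m K : 1 < s -> m <= K ->
  (\sum_(m.+1 <= b < K.+1) s ^ (K - b)).+1 <= s ^ (K - m).
Proof.
move=> s1; elim: K => [|K IHK].
  by rewrite leqn0 => /eqP->; rewrite big_geq.
rewrite leq_eqVlt => /orP[/eqP->|]; first by rewrite big_geq // subnn.
rewrite ltnS => le_mK; rewrite big_nat_recr //= subnn subSn // expnS.
apply: leq_trans (leq_mul (leqnn s) (IHK le_mK)).
rewrite (eq_big_nat _ _ (F2 := fun b => s * s ^ (K - b))); last first.
  by move=> b /andP[_ bK]; rewrite subSn // expnS.
by rewrite -big_distrr /=; nia.
Qed.

Definition other_letter (a : A) := odflt a [pick y | y != a].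

Lemma other_letter_neq a : 1 < #|A| -> other_letter a != a.
Proof.
rewrite /other_letter; case: pickP => //= eq_a; rewrite ltnNge => /negP[].
by apply/card_le1_eqP => x y _ _; move/negbFE/eqP: (eq_a x) ->;
   move/negbFE/eqP: (eq_a y).
Qed.

(** * Blocks of equal letters and bordered suffixes *)

Section Blocks.
Variables (n m : nat).

Definition block k (t : 'I_k) (j : 'I_m) : 'I_n.+1 := inord (t * m + j).

Lemma block_inj k : k * m <= n -> forall t j t' j',
  @block k t j = block t' j' -> t = t' /\ j = j'.
Proof.
move=> le_kn t j t' j' /(congr1 val) /=.
have bnd (s : 'I_k) (i : 'I_m) : s * m + i < n.+1.
  have := leq_mul (ltn_ord s) (leqnn m); have := ltn_ord i; lia.
rewrite !inordK // => eq_v.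
have m0 : 0 < m by apply: leq_trans (ltn_ord j).
have et : t = t' :> nat.
  by have := congr1 (divn^~ m) eq_v; rewrite !divnMDl // !divn_small // !addn0.
by split; apply: val_inj => //=; move: eq_v; rewrite et => /addnI.
Qed.

Lemma block_neq_max k (t : 'I_k) j : k * m <= n -> ord_max != block t j.
Proof.
move=> le_kn; have := leq_mul (ltn_ord t) (leqnn m); have := ltn_ord j => lj lt.
by rewrite -val_eqE /= inordK; lia.
Qed.

(** It depends on the last letter alone, which no block contains, so overwriting a block preserves
    it. *)
Definition target (S : n.+1.-tuple A) := other_letter (tnth S ord_max).

Definition bordered_hit p b := [set S : n.+1.-tuple A |
  [forall j : 'I_m, tnth S (inord (p + j)) == target S] &&
  [forall x : 'I_b, tnth S (inord (p + x)) == tnth S (inord (n.+1 - b + x))]].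

(* The determined letters are the prefix of length [b], read off the suffix of
   length [b], and the first [m] letters of that suffix, equal to the target. *)
Lemma card_bordered_hit p b : m < b -> p + b.*2 <= n.+1 ->
  #|bordered_hit p b| * #|A| ^ (b + m) <= #|A| ^ n.+1.
Proof.
move=> lt_mb le_pn.
pose v j := if j < b then p + j else n.+1 - b + (j - b).
have v_lt (j : 'I_(b + m)) : v j < n.+1.
  by have := ltn_ord j; rewrite /v; case: ifP; lia.
pose e (j : 'I_(b + m)) : 'I_n.+1 := Ordinal (v_lt j).
have in_e (x : 'I_n.+1) j : j < b + m -> val x = v j -> x \in codom e.
  by move=> lt_j xj; apply/codomP; exists (Ordinal lt_j); apply: val_inj.
apply: (card_determined (e := e)) => [i j /(congr1 val) /=|S S'].
  have := ltn_ord i; have := ltn_ord j; move=> lj li eq_v; apply: val_inj => /=.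
  by move: eq_v; rewrite /v; case: ifP; case: ifP; lia.
rewrite !inE => /andP[/forallP hS /forallP bS] /andP[/forallP hS' /forallP bS'].
move=> eqS.
(* As [m < b], the last letter is not among the determined ones. *)
have eq_max : target S = target S'.
  rewrite /target eqS //; apply/codomP=> -[j /(congr1 val)] /=.
  by have := ltn_ord j; rewrite /v; case: ifP; lia.
have eq_suf x : n.+1 - b <= x < n.+1 -> tnth S (inord x) = tnth S' (inord x).
  move=> /andP[le_x lt_x]; have [lt_xm|le_mx] := ltnP x (n.+1 - b + m); last first.
    apply: eqS; apply/codomP=> -[j /(congr1 val)] /=.
    by rewrite inordK //; have := ltn_ord j; rewrite /v; case: ifP; lia.
  have lt_ym : x - (n.+1 - b) < m by lia.
  have lt_yb := ltn_trans lt_ym lt_mb.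
  have := bS (Ordinal lt_yb); have := bS' (Ordinal lt_yb).
  have := hS (Ordinal lt_ym); have := hS' (Ordinal lt_ym).
  by rewrite /= subnKC // => /eqP-> /eqP-> /eqP<- /eqP<-.
apply: eq_from_tnth => x; have lt_x := ltn_ord x.
rewrite -[x]inord_val.
have [le_x|gt_x] := leqP (n.+1 - b) x; first by apply: eq_suf; rewrite le_x.
have [/andP[le_px lt_px]|out] := boolP (p <= x < p + b); last first.
  apply: eqS; rewrite inord_val; apply/codomP=> -[j /(congr1 val)] /=.
  by have := ltn_ord j; rewrite /v; case: ifP; lia.
have lt_yb : x - p < b by lia.
have := bS (Ordinal lt_yb); have := bS' (Ordinal lt_yb).
by rewrite /= subnKC // => /eqP-> /eqP->; apply: eq_suf; lia.
Qed.

Lemma onth_tnth (S : n.+1.-tuple A) x : x < n.+1 ->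
  onth S x = Some (tnth S (inord x)).
Proof.
move=> lt_x; have a := tnth S ord_max.
by rewrite onthE (nth_map a) ?size_tuple // (tnth_nth a) inordK.
Qed.

Lemma unbordered_suffix_hit (S : n.+1.-tuple A) p : 1 < #|A| -> p + m <= n ->
  (forall j : 'I_m, tnth S (inord (p + j)) = target S) ->
  (forall b, m < b -> p + b.*2 <= n.+1 -> S \notin bordered_hit p b) ->
  unbordered (factor S p.+1 n.+1).
Proof.
move=> A1 le_pn hitS nobord.
have bnd : factor_bounds S p.+1 n.+1 by rewrite /factor_bounds size_tuple; lia.
apply/(unbordered_factorP bnd)/borderless_short => b b0 le_b ov.
have {}ov x : x < b -> tnth S (inord (p + x)) = tnth S (inord (n.+1 - b + x)).
  move=> lt_x; have := ov x lt_x; rewrite /= !onth_tnth; try lia.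
  by case=> ->; congr (tnth S (inord _)); lia.
(* A border of length at most [m] would end both in the target and in the last letter. *)
have [le_bm|lt_mb] := leqP b m.
  have lt_b : b.-1 < m by lia.
  have := other_letter_neq (tnth S ord_max) A1; rewrite -/(target S).
  rewrite -(hitS (Ordinal lt_b)) /= ov; last by lia.
  rewrite (_ : inord _ = ord_max) ?eqxx //.
  by apply: val_inj; rewrite /= inordK; lia.
have /negP[] := nobord b lt_mb ltac:(lia).
rewrite inE; apply/andP; split; apply/forallP => x; apply/eqP.
  exact: hitS.
exact: ov.
Qed.

End Blocks.

(* With T blocks of length m, no block is hit with probability at most s^m / T,
   and some hit has a border with probability at most T / s^(2 m).  Both are
   s^-k for m = 2 k and T = s^(3 k). *)
Lemma few_bordered k n :
  1 < #|A| -> #|A| ^ (3 * k) * (2 * k) <= n -> 4 * k <= n ->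
  exists2 Bad : {set n.+1.-tuple A}, #|Bad| * #|A| ^ k <= 2 * #|A| ^ n.+1 &
  forall S, S \notin Bad -> exists2 p, p <= #|A| ^ (3 * k) * (2 * k) &
    unbordered (factor S p.+1 n.+1).
Proof.
set s := #|A|; set m := 2 * k; set T := s ^ (3 * k) => s1 le_Tn le_4kn.
pose Z := [set S : n.+1.-tuple A |
  [forall t : 'I_T, ~~ hits (@block n m T t) (target S) S]].
pose B := \bigcup_(t : 'I_T) \bigcup_(m.+1 <= b < (n.+1 - m).+1 |
            t * m + b.*2 <= n.+1) bordered_hit n m (t * m) b.
have s_gt0 : 0 < s by apply: ltnW.
have cardZ : #|Z| * T <= s ^ (n.+1 + m).
  apply: card_no_hit => [|S S' eqS]; first exact: block_inj.
  by rewrite /target eqS // => t j; apply: block_neq_max.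
have cardB : #|B| <= T * s ^ (n.+1 - m - m).
  apply: leq_trans (leq_card_bigcup _ _ _) _.
  rewrite -[T in T * _]card_ord -sum_nat_const; apply: leq_sum => t _.
  apply: leq_trans (leq_card_bigcup _ _ _) _.
  (* With [K = n.+1 - m], length [b] contributes at most [s ^ (K - b)]. *)
  apply: leq_trans (ltnW (sum_expn_lt s1 _)); last by lia.
  rewrite big_mkcond !big_nat; apply: leq_sum => b /andP[lt_mb lt_bn].
  case: ifP => // le_tb; rewrite -(@leq_pmul2r (s ^ (b + m))) ?expn_gt0 ?s_gt0 //.
  apply: leq_trans (card_bordered_hit lt_mb le_tb) _.
  by rewrite -expnD -/s (_ : n.+1 - m - b + (b + m) = n.+1) //; lia.
exists (Z :|: B) => [|S].
  rewrite cardsU; apply: (@leq_trans ((#|Z| + #|B|) * s ^ k)).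
    by rewrite leq_mul2r leq_subr orbT.
  rewrite mulnDl mul2n -addnn; apply: leq_add.
    rewrite -(@leq_pmul2r (s ^ m)) ?expn_gt0 ?s_gt0 // -mulnA -!expnD.
    by rewrite (_ : k + m = 3 * k) // /m; lia.
  apply: leq_trans (leq_mul cardB (leqnn _)) _.
  by rewrite -!expnD leq_exp2l // /m; lia.
rewrite !inE negb_or negb_forall => /andP[/existsP[t]].
rewrite negbK => /forallP hitS nobord.
have le_tT : t * m + m <= T * m by rewrite -mulSnr leq_mul2r ltn_ord orbT.
exists (t * m); first by lia.
apply: (unbordered_suffix_hit (m := m)) => // [|j|b lt_mb le_b]; first by lia.
  exact/eqP/hitS.
apply: contra nobord => inS; apply/bigcupP; exists t => //.
have in_b : b \in index_iota m.+1 (n.+1 - m).+1 by rewrite mem_index_iota; lia.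
by rewrite big_mkcond (bigD1_seq b in_b (iota_uniq _ _)) /= le_b inE inS.
Qed.

End Counting.

(** The constant is 44 + 22: bad strings, a fraction of at most [2 / #|A| ^ k], take the worst-case
    time; the others take [22 * n.+1 * d.+1]. *)
Lemma sum_scan_time_le (A : finType) n d k (Bad : {set n.+1.-tuple A}) :
  (#|Bad| * #|A| ^ k <= 2 * #|A| ^ n.+1)%N ->
  (forall S, S \notin Bad ->
     exists2 p, (p <= d)%N & unbordered (factor S p.+1 n.+1)) ->
  (d <= n)%N -> (d.+1 * #|A| ^ k <= n.+1)%N ->
  ((\sum_(S : n.+1.-tuple A) scan_time S) * #|A| ^ k
     <= 66 * n.+1 ^ 2 * #|A| ^ n.+1)%N.
Proof.
move=> few good le_dn le_dk.
rewrite (bigID (mem Bad)) /= mulnDl.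
have -> : (66 * n.+1 ^ 2 * #|A| ^ n.+1 = 22 * n.+1 ^ 2 * (2 * #|A| ^ n.+1)
    + 22 * n.+1 ^ 2 * #|A| ^ n.+1)%N by lia.
apply: leq_add.
  apply: (@leq_trans (22 * n.+1 ^ 2 * (#|Bad| * #|A| ^ k)))%N; last first.
    by rewrite leq_mul2l few orbT.
  rewrite mulnA leq_mul2r mulnC -sum_nat_const; apply/orP; right.
  apply: leq_sum => S _; have := @scan_time_le_sqr _ (val S).
  by rewrite size_tuple -mulnA; apply=> S0; have := size_tuple S; rewrite S0.
apply: (@leq_trans (22 * n.+1 * d.+1 * #|A| ^ n.+1 * #|A| ^ k))%N; last first.
  rewrite mulnAC leq_mul2r; apply/orP; right.
  by rewrite -mulnA -mulnn (mulnA 22) leq_mul2l le_dk orbT.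
rewrite leq_mul2r [X in (_ <= X)%N]mulnC -card_tuple -sum_nat_const.
apply/orP; right; apply: (@leq_trans (\sum_(S | S \notin Bad) 22 * n.+1 * d.+1))%N.
  apply: leq_sum => S /good[p le_p unb].
  have bnd : factor_bounds S p.+1 n.+1.
    by rewrite /factor_bounds size_tuple; split; lia.
  apply: leq_trans (scan_time_le bnd unb) _.
  by rewrite (size_factor bnd) size_tuple leq_mul2l; lia.
by rewrite !sum_nat_const leq_mul2r max_card orbT.
Qed.

Theorem theorem3 :
  exists (P : program) (time : forall A : finType, seq A -> nat) (C : rat),
    (forall (A : finType) (S : seq A), S <> [::] ->
       exists i j : nat,
         outputs_in P S (time A S) i j /\ maximal_unbordered_factor S i j) /\
    (forall sigma : nat, (0 < sigma)%N ->
       exists N : nat, forall (A : finType) (n : nat),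
         #|A| = sigma -> (N <= n)%N ->
         average n (time A) <= C * (n%:R ^+ 2 / sigma%:R ^+ 4)).
Proof.
exists scan_program, (fun A => @scan_time A), 66%:R; split.
  by move=> A S; apply: scan_correct.
move=> s s_gt0; move: (erefl (s ^ (3 * 4) * (2 * 4))%N); move: {2}(_ * _)%N => d dE.
(* Here [d] is the total length of the blocks for [k = 4]; the 17 ensures [4 * k <= n] once [n] is
   replaced by its predecessor. *)
exists (d.+1 * s ^ 4 + 17)%N => A n cardA le_n.
have n_gt0 : (0 < n)%N by apply: leq_trans le_n; rewrite addnS.
rewrite -(prednK n_gt0) in le_n *; move: n.-1 le_n => {n_gt0}n le_n.
have le_d : (d.+1 <= d.+1 * s ^ 4)%N by rewrite leq_pmulr ?expn_gt0 ?s_gt0.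
have sum_le : ((\sum_(S : n.+1.-tuple A) scan_time S) * s ^ 4
    <= 66 * n.+1 ^ 2 * s ^ n.+1)%N.
  have [s1|s1] := leqP s 1.
    have {s_gt0} s1 : s = 1%N by lia.
    (* For one letter, all strings may count as bad. *)
    have:= @sum_scan_time_le A n 0 4 [set: _]; rewrite cardA s1 !exp1n; apply.
    - by rewrite cardsT card_tuple cardA s1 exp1n.
    - by move=> S; rewrite inE.
    - by [].
    - by [].
  have A1 : (1 < #|A|)%N by rewrite cardA.
  have [||Bad few good] := @few_bordered A 4 n A1; rewrite ?cardA ?dE; try lia.
  rewrite cardA dE in good.
  by have := @sum_scan_time_le A n d 4 Bad few good; rewrite cardA; apply; lia.
have strings_gt0 : 0 < (s ^ n.+1)%:R :> rat by rewrite ltr0n expn_gt0 s_gt0.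
have s4_gt0 : 0 < s%:R ^+ 4 :> rat by rewrite exprn_gt0 ?ltr0n.
rewrite /average cardA mulrA ler_pdivrMr; last exact: strings_gt0.
rewrite mulrAC ler_pdivlMr; last exact: s4_gt0.
move: sum_le; move: 66%N (\sum_(S : _) _)%N (s ^ n.+1)%N => c t u.
by rewrite -!natrX -!natrM ler_nat.
Qed.
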